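(* Two finite simple graphs $G$ and $H$ are singularly cospectral if and only if, for each positive integer $k$, $G$ and $H$ have the same number of closed walks of length $2k$.
   Context: All graphs are finite, without loops or multiple edges. The singular values of a graph are the singular values of its adjacency matrix (equivalently, the absolute values of its eigenvalues). Two graphs are singularly cospectral if they have the same nonzero singular values with the same multiplicities (they need not have the same number of vertices). *)

(* Defs.v *)
From HB Require Import structures.
From mathcomp Require Import all_boot all_order all_algebra.
Set Implicit Arguments.
Unset Strict Implicit.
Unset Printing Implicit Defensive.
Import GRing.Theory Num.Theory.
Local Open Scope ring_scope.

Record sgraph := SGraph {
  vertex :> finType;
  edge : rel vertex;
  edge_sym : symmetric edge;
  edge_irrefl : irreflexive edge
}.

Definition adjmx (R : rcfType) (G : sgraph) : 'M[R]_#|G| :=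
  \matrix_(i, j) (edge (enum_val i) (enum_val j))%:R.

(* The singular values of M are the nonnegative square roots of the
   eigenvalues of M^T *m M, each counted with the algebraic multiplicity of
   the corresponding eigenvalue. *)
Definition singular_value (R : rcfType) (m n : nat) (M : 'M[R]_(m, n))
    (s : R) : bool :=
  (0 <= s) && eigenvalue (M^T *m M) (s ^+ 2).

(* Only meaningful when s is a singular value of M. *)
Definition singular_mult (R : rcfType) (m n : nat) (M : 'M[R]_(m, n))
    (s : R) : nat :=
  mup (s ^+ 2) (char_poly (M^T *m M)).

Definition singularly_cospectral (R : rcfType) (G H : sgraph) : Prop :=
  (forall s : R, s != 0 ->
     singular_value (adjmx R G) s = singular_value (adjmx R H) s) /\
  (forall s : R, s != 0 -> singular_value (adjmx R G) s ->
     singular_mult (adjmx R G) s = singular_mult (adjmx R H) s).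

(* A walk of length k is its sequence of k + 1 vertices; closed walks are
   rooted and oriented, i.e. they are counted as vertex sequences. *)
Definition closed_walks (G : sgraph) (k : nat) : {set k.+1.-tuple G} :=
  [set w : k.+1.-tuple G |
    sorted (@edge G) w && (tnth w ord0 == tnth w ord_max)].

(* Main.v *)
(** The number of closed walks of length [k] is the trace of [A ^+ k], that is
    the sum of the [k]-th powers of the eigenvalues of the adjacency matrix
    [A], which are real by the spectral theorem.  Even powers only see their
    squares, the squared singular values.  Hence the statement says that two
    finite families in a field of characteristic zero agree outside 0 if and
    only if all their power sums of positive degree agree; for the converse, a
    polynomial vanishing at 0 and at every member of both families but [t]
    isolates the multiplicity of [t]. *)
Require Import Defs.
From mathcomp Require Import all_boot all_order all_algebra.
From mathcomp Require Import complex.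

Set Implicit Arguments.
Unset Strict Implicit.
Unset Printing Implicit Defensive.

Import Order.TTheory GRing.Theory Num.Theory.
Local Open Scope ring_scope.

Lemma char_poly_conj (R : comUnitRingType) (n : nat) (P A : 'M[R]_n) :
  P \in unitmx -> char_poly (invmx P *m A *m P) = char_poly A.
Proof.
move=> Pu; rewrite /char_poly.
pose Q := map_mx polyC P; pose Q' := map_mx polyC (invmx P).
have Q'Q : Q' *m Q = 1%:M by rewrite -map_mxM mulVmx // map_mx1.
have -> : char_poly_mx (invmx P *m A *m P) = Q' *m char_poly_mx A *m Q.
  rewrite /char_poly_mx mulmxBr mulmxBl !map_mxM -/Q -/Q'; congr (_ - _).
  by rewrite mul_mx_scalar -scalemxAl Q'Q scalemx1.
by rewrite !det_mulmx mulrAC -det_mulmx Q'Q det1 mul1r.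
Qed.

Lemma conj_exp (R : comUnitRingType) (n : nat) (P A : 'M[R]_n) (k : nat) :
  P \in unitmx -> (invmx P *m A *m P) ^+ k = invmx P *m A ^+ k *m P.
Proof.
move=> Pu; elim: k => [|k IHk]; first by rewrite !expr0 mulmx1 mulVmx.
by rewrite !exprS IHk -!mulmxE !mulmxA mulmxK.
Qed.

Lemma diag_mx_exp (R : pzSemiRingType) (n : nat) (d : 'rV[R]_n) (k : nat) :
  diag_mx d ^+ k = diag_mx (\row_j d 0 j ^+ k).
Proof.
elim: k => [|k IHk].
  by rewrite expr0; apply/matrixP=> i j; rewrite !mxE expr0.
rewrite exprS IHk -mulmxE mulmx_diag; congr diag_mx.
by apply/rowP=> j; rewrite !mxE exprS.
Qed.

Lemma map_mx_exp (R S : pzSemiRingType) (f : {rmorphism R -> S}) (n : nat)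
    (A : 'M[R]_n) (k : nat) :
  map_mx f (A ^+ k) = map_mx f A ^+ k.
Proof.
elim: k => [|k IHk]; first by rewrite !expr0 map_mx1.
by rewrite !exprS -!mulmxE map_mxM IHk.
Qed.

(** Over [R[i]] the image [B] of [A] is normal, hence unitarily diagonalisable, and its eigenvalues
    are real since it is Hermitian. Both identities therefore descend along the injective embedding
    [f]. That one list [s] serves both is what links singular values to walks. *)
Lemma symmetric_mx_spectrum (R : rcfType) (n : nat) (A : 'M[R]_n) :
  A^T = A ->
  exists2 s : seq R,
    char_poly (A^T *m A) = \prod_(x <- s) ('X - (x ^+ 2)%:P) &
    forall k, \tr (A ^+ k) = \sum_(x <- s) x ^+ k.
Proof.
move=> Asym; pose f := real_complex R; pose B := map_mx f A.
have Bsym : B \is symmetricmx.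
  by apply/is_hermitianmxP; rewrite expr0 scale1r map_mx_id // map_trmx Asym.
have Breal : B \is a mxOver Num.real.
  by apply/mxOverP=> i j; rewrite mxE complex_real.
have Bspec := orthomx_spectralP (symmetric_normalmx Bsym Breal).
have /mxOverP dreal :=
  hermitian_spectral_diag_real (realsym_hermsym Bsym Breal).
set P := spectralmx B in Bspec; set d := spectral_diag B in Bspec dreal.
have Pu : P \in unitmx by apply: spectral_unit.
pose x i := complex.Re (d 0 i).
have dE i : d 0 i = f (x i) by rewrite /f /x; apply/esym/RRe_real/dreal.
exists [seq x i | i <- enum 'I_n].
  apply: (map_poly_inj f).
  rewrite big_map big_enum map_prod_XsubC map_char_poly Asym.
  have -> : map_mx f (A *m A) = B ^+ 2 by rewrite map_mxM expr2.
  rewrite Bspec conj_exp // char_poly_conj // diag_mx_exp.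
  rewrite char_poly_trig ?diag_mx_is_trig //.
  by apply: eq_bigr => i _; rewrite !mxE eqxx mulr1n dE -rmorphXn.
move=> k; apply: (fmorph_inj f).
rewrite big_map big_enum -[LHS]trace_map_mx rmorph_sum map_mx_exp -/B.
rewrite Bspec conj_exp // mxtrace_mulC mulmxA mulmxV // mul1mx.
rewrite diag_mx_exp mxtrace_diag.
by apply: eq_bigr => i _; rewrite !mxE dE -rmorphXn.
Qed.

Lemma sum_cons_tuple (V : nmodType) (T : finType) (k : nat)
    (F : k.+1.-tuple T -> V) :
  \sum_w F w = \sum_x \sum_(w : k.-tuple T) F [tuple of x :: w].
Proof.
rewrite pair_big /= (reindex (fun p : T * k.-tuple T => [tuple of p.1 :: p.2])) //.
exists (fun w : k.+1.-tuple T => (thead w, [tuple of behead w])).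
  by move=> [x w] _ /=; congr (_, _); apply: val_inj.
by move=> w _; rewrite [RHS]tuple_eta.
Qed.

(** The tuple [w] omits the starting vertex, so the induction on [k] splits off the first step of
    the walk. *)
Lemma adjmx_exp (R : rcfType) (G : sgraph) (k : nat) (i j : 'I_#|G|) :
  (adjmx R G ^+ k) i j =
  \sum_(w : k.-tuple G)
    (path (@edge G) (enum_val i) w && (last (enum_val i) w == enum_val j))%:R.
Proof.
elim: k i => [|k IHk] i.
  rewrite expr0 mxE (big_pred1 [tuple]) => [|w]; last first.
    by rewrite [w]tuple0; apply/esym/eqP.
  by rewrite /= (inj_eq enum_val_inj).
rewrite exprS -mulmxE mxE sum_cons_tuple.
rewrite (big_enum_val (A := G)) /=.
apply: eq_bigr => l _; rewrite IHk mxE big_distrr.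
by apply: eq_bigr => w _ /=; rewrite -andbA -natrM mulnb.
Qed.

Lemma card_closed_walks (R : rcfType) (G : sgraph) (k : nat) :
  #|closed_walks G k|%:R = \tr (adjmx R G ^+ k).
Proof.
rewrite -sum1_card natr_sum big_mkcond sum_cons_tuple /=.
rewrite (big_enum_val (A := G)) /=.
apply: eq_bigr => i _; rewrite adjmx_exp; apply: eq_bigr => w _.
rewrite inE /= !(tnth_nth (enum_val i)) /= eq_sym.
(* The index [ord_max] has value [k], the size of [w], so it points to the last vertex of the
   walk. *)
rewrite -[X in nth _ _ X](size_tuple w) -last_nth.
by case: (_ && _).
Qed.

Lemma power_sums_count (R : numFieldType) (s t : seq R) :
  (forall k, (0 < k)%N -> \sum_(x <- s) x ^+ k = \sum_(x <- t) x ^+ k) <->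
  (forall a, a != 0 -> count_mem a s = count_mem a t).
Proof.
split=> [eq_st a a0 | eq_st k k0].
  (* The factor ['X] removes the constant term, so only power sums of positive degree occur. *)
  have eq_poly (p : {poly R}) :
      \sum_(x <- s) (p * 'X).[x] = \sum_(x <- t) (p * 'X).[x].
    have sumE (u : seq R) : \sum_(x <- u) (p * 'X).[x] =
        \sum_(i < size p) p`_i * \sum_(x <- u) x ^+ i.+1.
      under eq_bigr => x _ do rewrite hornerM hornerX horner_coef big_distrl.
      rewrite exchange_big /=; apply: eq_bigr => i _; rewrite big_distrr /=.
      by apply: eq_bigr => x _; rewrite -mulrA -exprSr.
    by rewrite !sumE; apply: eq_bigr => i _; rewrite eq_st.
  pose q := \prod_(z <- [seq z <- s ++ t | z != a]) ('X - z%:P).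
  have qa : (q * 'X).[a] != 0.
    rewrite hornerM hornerX mulf_neq0 // -/(root q a) root_prod_XsubC.
    by rewrite mem_filter eqxx.
  have sumq (u : seq R) : {subset u <= s ++ t} ->
      \sum_(x <- u) (q * 'X).[x] = (q * 'X).[a] *+ count_mem a u.
    (* The multiple becomes a sum of constants over the entries equal to [a]; all other entries of
       [u] are roots of [q]. *)
    move=> ust; rewrite -iter_addr_0 -big_const_seq [RHS]big_mkcond.
    apply: eq_big_seq => x xu; rewrite /=; case: eqP => [-> // | /eqP xa].
    rewrite hornerM; suff /rootP -> : root q x by rewrite mul0r.
    by rewrite root_prod_XsubC mem_filter xa ust.
  have := eq_poly q; rewrite !sumq.
  (* Characteristic zero: natural multiples of a nonzero element determine the multiplier. *)
  - by move/(mulrIn qa).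
  - by move=> x xt; rewrite mem_cat xt orbT.
  - by move=> x xs; rewrite mem_cat xs.
(* As [k] is positive, zeros contribute nothing; once they are dropped, the two lists are
   permutations of each other. *)
have sumE (u : seq R) :
    \sum_(x <- u) x ^+ k = \sum_(x <- [seq x <- u | x != 0]) x ^+ k.
  rewrite big_filter [RHS]big_mkcond; apply: eq_bigr => x _.
  by case: eqP => // ->; rewrite expr0n; case: k k0.
rewrite sumE [RHS]sumE; apply: perm_big; apply/allP=> a _ /=.
rewrite !count_filter.
have [-> | a0] := eqVneq a 0.
  by rewrite !(@eq_count _ _ pred0) ?count_pred0 // => z /=; case: eqP.
have E (u : seq R) : count (predI (pred1 a) (fun x => x != 0)) u = count_mem a u.
  by apply: eq_count => z /=; case: eqP => // ->.
by rewrite !E eq_st.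
Qed.

Theorem theorem3p6 (R : rcfType) (G H : sgraph) :
  singularly_cospectral R G H <->
  (forall k : nat, (0 < k)%N ->
     #|closed_walks G (2 * k)| = #|closed_walks H (2 * k)|).
Proof.
have adj_sym (K : sgraph) : (adjmx R K)^T = adjmx R K.
  by apply/matrixP=> i j; rewrite !mxE edge_sym.
have [s sP sT] := symmetric_mx_spectrum (adj_sym G).
have [t tP tT] := symmetric_mx_spectrum (adj_sym H).
pose sq (u : seq R) := [seq x ^+ 2 | x <- u].
have walksE : (forall k, (0 < k)%N ->
       #|closed_walks G (2 * k)| = #|closed_walks H (2 * k)|) <->
    (forall k, (0 < k)%N ->
       \sum_(x <- sq s) x ^+ k = \sum_(x <- sq t) x ^+ k).
  have sumE (u : seq R) k : \sum_(x <- sq u) x ^+ k = \sum_(x <- u) x ^+ (2 * k).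
    by rewrite big_map; apply: eq_bigr => x _; rewrite exprM.
  split=> E k k0; first by rewrite !sumE -sT -tT -!card_closed_walks E.
  apply/eqP; rewrite -(eqr_nat R) !(card_closed_walks R) sT tT.
  by rewrite -!sumE E.
have multG a : singular_mult (adjmx R G) a = count_mem (a ^+ 2) (sq s).
  by rewrite /singular_mult sP -mu_prod_XsubC big_map.
have multH a : singular_mult (adjmx R H) a = count_mem (a ^+ 2) (sq t).
  by rewrite /singular_mult tP -mu_prod_XsubC big_map.
have valG a : singular_value (adjmx R G) a = (0 <= a) && (a ^+ 2 \in sq s).
  by rewrite /singular_value eigenvalue_root_char sP -root_prod_XsubC big_map.
have valH a : singular_value (adjmx R H) a = (0 <= a) && (a ^+ 2 \in sq t).
  by rewrite /singular_value eigenvalue_root_char tP -root_prod_XsubC big_map.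
rewrite walksE power_sums_count; split=> [[eqv eqm] b b0 | E].
  (* A negative [b] is not a square and has count 0 on both sides; a positive one is tested at the
     singular value [Num.sqrt b]. *)
  have [b_ge0 | b_lt0] := leP 0 b; last first.
    have neg (u : seq R) : count_mem b (sq u) = 0%N.
      apply/count_memPn/mapP => -[x _ bE].
      by move: b_lt0; rewrite bE ltNge sqr_ge0.
    by rewrite !neg.
  have a0 : Num.sqrt b != 0 by rewrite sqrtr_eq0 -ltNge lt_def b0.
  have := eqv _ a0; have := eqm _ a0.
  rewrite multG multH valG valH sqrtr_ge0 sqr_sqrtr //=.
  (* Multiplicities are compared only at singular values of [G]. Elsewhere [eqv] shows that [b] lies
     in neither list, so both counts are 0. *)
  have [_ -> // | sb _ /esym tb] := boolP (b \in sq s).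
  by rewrite (count_memPn sb) (count_memPn (negbT tb)).
have Ea a : a != 0 -> count_mem (a ^+ 2) (sq s) = count_mem (a ^+ 2) (sq t).
  by move=> a0; apply: E; rewrite expf_neq0.
split=> a a0; last by rewrite multG multH Ea.
by rewrite valG valH -!has_pred1 !has_count Ea.
Qed.
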